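(* Let $V$ be a Lorentz $3$-plane (signature $(+,+,-)$) with a curvature tensor $R$, and suppose there is an interval $[K_1,K_2]$ of curvature bounds below on $V$, where $K_1<K_2$. Then the curvature operator $\mathcal{R}:\bigwedge^2V\to\bigwedge^2V$ is diagonalizable. Let $t$ be a unit timelike vector perpendicular to the spacelike eigenbivector of $\mathcal{R}$. Then $$K_2-K_1=\min_v\mathcal{K}_x(\Pi),$$ where $v$ runs over unit vectors of $V$ perpendicular to $t$, and $x$ and $\Pi$ are the null vector and null section $x=t+v$ and $\Pi=x^\perp$ (in $V$) respectively. If instead there is an interval $[K_1,K_2]$ of curvature bounds above on $V$, where $K_1<K_2$, the same holds with the displayed equation replaced by $$K_1-K_2=\max_v\mathcal{K}_x(\Pi).$$
   Context: $R$ is an algebraic curvature tensor on $V$. A number $K$ is a curvature bound below on $V$ if $R(v,w,v,w)\ge K(\langle v,v\rangle\langle w,w\rangle-\langle v,w\rangle^2)$ for all $v,w\in V$, and a curvature bound above if the reverse inequality holds. The interval $[K_1,K_2]$ of curvature bounds below (above) is the full set of such numbers $K$. $\bigwedge^2V$ carries the natural inner product, $\langle v\wedge w,v\wedge w\rangle=\langle v,v\rangle\langle w,w\rangle-\langle v,w\rangle^2$, and $\mathcal{R}$ is the self-adjoint operator with $\langle\mathcal{R}(v\wedge w),v\wedge w\rangle=R(v,w,v,w)$. Every nonzero bivector is decomposable and represents a section (2-plane) of $V$; it is spacelike or timelike according as its square norm is positive or negative. A vector is perpendicular to a bivector if it is perpendicular to the section the bivector represents. For a null vector $x\neq0$ and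 a null (degenerate) section $\Pi$ containing $x$, the null curvature of $\Pi$ with respect to $x$ is $\mathcal{K}_x(\Pi)=R(w,x,w,x)/\langle w,w\rangle$ for any nonnull vector $w\in\Pi$ (independent of $w$). *)

(* Defs.v *)
From HB Require Import structures.
From mathcomp Require Import all_boot all_order all_algebra.
From mathcomp Require Import boolp classical_sets reals.
From mathcomp Require Import ring.

Set Implicit Arguments.
Unset Strict Implicit.
Unset Printing Implicit Defensive.

Import Order.TTheory GRing.Theory Num.Theory.
Local Open Scope ring_scope.

Section LorentzVectorSpace.
Context {R : realType} {V : vectType R}.
Implicit Types (g : {symmetric V}) (T : V -> V -> V -> V -> R).
Implicit Types (v w x t : V) (P : {vspace V}) (K : R).

Definition lorentz3 g : Prop :=
  exists2 e : 3.-tuple V, basis_of {:V} e &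
    forall i j : 'I_3,
      g e`_i e`_j = if i != j then 0 else if (i < 2)%N then 1 else -1.

Definition timelike g v : Prop := g v v < 0.
Definition unit_vector g v : Prop := `|g v v| = 1.

(* The sign convention is the one in which [T v w v w] is the numerator of the
   sectional curvature of the plane spanned by [v] and [w]. *)
Record algebraic_curvature_tensor T : Prop := AlgebraicCurvatureTensor {
  curv_lin1 : forall y z w a x x',
    T (a *: x + x') y z w = a * T x y z w + T x' y z w;
  curv_lin2 : forall x z w a y y',
    T x (a *: y + y') z w = a * T x y z w + T x y' z w;
  curv_lin3 : forall x y w a z z',
    T x y (a *: z + z') w = a * T x y z w + T x y z' w;
  curv_lin4 : forall x y z a w w',
    T x y z (a *: w + w') = a * T x y z w + T x y z w';
  curv_skew12 : forall x y z w, T x y z w = - T y x z w;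
  curv_skew34 : forall x y z w, T x y z w = - T x y w z;
  curv_pair : forall x y z w, T x y z w = T z w x y;
  curv_bianchi : forall x y z w, T x y z w + T y z x w + T z x y w = 0
}.

Definition curv_bound_below g T K : Prop :=
  forall v w, T v w v w >= K * (g v v * g w w - g v w ^+ 2).
Definition curv_bound_above g T K : Prop :=
  forall v w, T v w v w <= K * (g v v * g w w - g v w ^+ 2).

(* [xget] picks an arbitrary nonnull vector of [P]; the value does not depend
   on it when [P] is a null section containing [x], see [null_curvatureE]. *)
Definition null_curvature g T x P : R :=
  let w := xget 0 [set w | w \in P /\ g w w != 0]%classic in
  T w x w x / g w w.

End LorentzVectorSpace.

Definition is_min {R : realType} (A : set R) (m : R) : Prop :=
  A m /\ lbound A m.
Definition is_max {R : realType} (A : set R) (m : R) : Prop :=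
  A m /\ ubound A m.

Section Bivectors.
Context {R : realType}.

(* The exterior square of [V], modelled by the skew-symmetric matrices of
   components in the basis [vbasis {:V}]: the bivector [v ^ w] has components
   [v_i w_j - v_j w_i]. *)
Definition skew_space (V : vectType R) : {vspace 'M[R]_(\dim {:V})} :=
  lker (linfun (fun A : 'M[R]_(\dim {:V}) => A + A^T)).

Definition bivector (V : vectType R) : vectType R := subvs_of (skew_space V).

Context {V : vectType R}.
Implicit Types (g : {symmetric V}) (T : V -> V -> V -> V -> R).
Implicit Types (v w t : V) (P : {vspace V}) (a b : bivector V).

Definition wedge_mx v w : 'M[R]_(\dim {:V}) :=
  let c i u := coord (vbasis {:V}) i u in
  \matrix_(i, j) (c i v * c j w - c j v * c i w).

Lemma wedge_mx_skew v w : wedge_mx v w \in skew_space V.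
Proof.
pose f (A : 'M[R]_(\dim {:V})) := A + A^T.
have flin : linear f.
  by move=> k A B; rewrite /f linearP/= scalerDr addrACA.
pose fL : {linear _ -> _} := HB.pack f (GRing.isLinear.Build _ _ _ _ f flin).
rewrite memv_ker -[linfun _]/(linfun fL) lfunE /=; apply/eqP/matrixP => i j.
by rewrite !mxE -opprB addNr.
Qed.

Definition wedge v w : bivector V := Subvs (wedge_mx_skew v w).

Definition gram g : 'M[R]_(\dim {:V}) :=
  \matrix_(i, j) g (vbasis {:V})`_i (vbasis {:V})`_j.

(* The natural inner product of bivectors, characterised by [bivipE] below:
   lowering both indices of [b] and contracting with [a]; the factor 1/2
   accounts for each basis bivector occurring twice in a skew matrix. *)
Definition bivip g a b : R :=
  2^-1 * \tr ((vsval a)^T *m gram g *m vsval b *m gram g).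

Definition curvature_operator g T (f : 'End(bivector V)) : Prop :=
  (forall a b, bivip g (f a) b = bivip g a (f b)) /\
  (forall v w, bivip g (f (wedge v w)) (wedge v w) = T v w v w).

Definition spacelike_bivector g b : Prop := 0 < bivip g b b.

Definition represents b P : Prop :=
  [/\ b != 0 & exists v w, b = wedge v w /\ P = (<[v]> + <[w]>)%VS].

Definition perp_bivector g t b : Prop :=
  exists2 P, represents b P & t \in orthov g P.

Definition eigenbivector (f : 'End(bivector V)) b : Prop :=
  b != 0 /\ exists k, f b = k *: b.

End Bivectors.

Definition diagonalizable_lfun {R : realType} {W : vectType R}
    (f : 'End(W)) : Prop :=
  exists2 e : seq W, basis_of {:W} e &
    forall u, u \in e -> exists k, f u = k *: u.

Section Characterizations.
Context {R : realType} {V : vectType R}.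
Implicit Types (g : {symmetric V}) (T : V -> V -> V -> V -> R).
Implicit Types (v w x : V) (P : {vspace V}).

Let c v : 'rV[R]_(\dim {:V}) := \row_i coord (vbasis {:V}) i v.

Let gE g v w : c v *m gram g *m (c w)^T = (g v w)%:M.
Proof.
rewrite [LHS]mx11_scalar; congr _%:M; rewrite -mulmxA mxE.
rewrite [in RHS](coord_vbasis (memvf v)) linear_sumlz.
apply: eq_bigr => i _; rewrite linearZl_LR !mxE; congr (_ * _).
rewrite [in RHS](coord_vbasis (memvf w)) linear_sumr.
by apply: eq_bigr => j _; rewrite linearZr_LR !mxE mulrC.
Qed.

Lemma bivipE g v w v' w' :
  bivip g (wedge v w) (wedge v' w') = g v v' * g w w' - g v w' * g w v'.
Proof.
have wedgeE x y : vsval (wedge x y) = (c x)^T *m c y - (c y)^T *m c x.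
  apply/matrixP => i j; rewrite !mxE !big_ord1 !mxE; congr (_ - _).
  exact: mulrC.
have gC x y : g x y = g y x by rewrite hermC expr0 mul1r.
have tr x y x' y' : \tr (((c x)^T *m c y)^T *m gram g *m ((c x')^T *m c y')
     *m gram g) = g x x' * g y y'.
  rewrite trmx_mul trmxK -!mulmxA mxtrace_mulC !mulmxA gE -!mulmxA.
  by rewrite [c y' *m _]mulmxA gE -scalar_mxM mxtrace_scalar (gC y').
rewrite /bivip !wedgeE [(_ - _)^T]raddfB /= !(mulmxBl, mulmxBr).
rewrite !(raddfB, raddfD, raddfN) /= !tr.
apply: (@mulfI _ 2); first by rewrite pnatr_eq0.
by rewrite mulVKf ?pnatr_eq0//; ring.
Qed.

Lemma null_curvatureE g T x w P :
  algebraic_curvature_tensor T -> g x x = 0 -> x != 0 -> x \in P ->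
  \dim P = 2 -> (P <= orthov g <[x]>)%VS -> w \in P -> g w w != 0 ->
  null_curvature g T x P = T w x w x / g w w.
Proof.
move=> HT gxx x0 xP dP Px wP gww; rewrite /null_curvature.
case: xgetP => [u -> /= [uP guu]|/(_ w)]; last by case; split.
have gC y z : g y z = g z y by rewrite hermC expr0 mul1r.
have PE : P = (<[x]> + <[w]>)%VS.
  apply/esym/eqP; rewrite eqEdim dP subv_add -!memvE xP wP /=.
  have d2 : (\dim <[x]> + \dim <[w]>)%N = 2%N.
    rewrite !dim_vline x0; case: (eqVneq w 0) gww => [->|//].
    by rewrite linear0l eqxx.
  suff xw0 : (<[x]> :&: <[w]> = 0)%VS by rewrite dimv_disjoint_sum // d2.
  apply/eqP; rewrite -subv0; apply/subvP => z; rewrite memv_cap memv0 => /andP[/vlineP[a ->] /vlineP[b e]].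
  have : g (a *: x) (a *: x) = 0 by rewrite linearZl_LR linearZr_LR/= gxx !mulr0.
  rewrite e linearZl_LR linearZr_LR /= => /eqP.
  by rewrite !mulf_eq0 (negPf gww) orbF orbb => /eqP->; rewrite scale0r.
have xw : g x w = 0 by apply/eqP; rewrite gC -mem_orthov1 (subvP Px).
move: uP guu; rewrite PE => /memv_addP[_ /vlineP[a ->] [_ /vlineP[b ->] ->]].
have -> : g (a *: x + b *: w) (a *: x + b *: w) = b * (b * g w w).
  rewrite linearDl !linearDr !linearZl_LR !linearZr_LR /= gxx (gC w) xw.
  by rewrite !mulr0 !add0r.
have T0 y z : T x x y z = 0.
  have := curv_skew12 HT x x y z => /eqP.
  by rewrite -addr_eq0 -mulr2n mulrn_eq0 /= => /eqP.
rewrite (curv_lin1 HT) T0 mulr0 add0r.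
have e1 y : T (b *: w) x y x = b * T w x y x.
  have T00 : T 0 x y x = 0.
    by have := curv_lin1 HT x y x (-1) 0 0; rewrite scaler0 addr0 mulN1r addNr.
  by have := curv_lin1 HT x y x b w 0; rewrite addr0 T00 addr0.
rewrite e1 (curv_pair HT) (curv_lin1 HT) T0 mulr0 add0r.
have e2 y : T (b *: w) x w x = b * T w x w x by rewrite e1.
rewrite e1 => H; have b0 : b != 0.
  by apply: contraNneq H => ->; rewrite mul0r.
by rewrite !mulrA invfM mulrACA; field; rewrite gww b0.
Qed.

End Characterizations.

(* Main.v *)
(* If A(b) = <Rop b, b> and Q(b) = <b, b>, every bivector of a Lorentz 3-space
   being decomposable, K is a curvature bound below iff A - K Q >= 0.  For K
   strictly between K1 and K2 the form A - K Q is positive definite: a vector on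
   which it vanishes is in the kernel of both A - K1 Q and A - K2 Q, hence of Q.
   As det Q = 1 in a Lorentz frame, det (A - K Q) > 0 says that the
   characteristic polynomial of Rop is negative at K; so it has a root above K,
   whose eigenbivectors are spacelike.  Taking the
   plane of such an eigenbivector as e0 ^ e1 in a Lorentz frame (e0, e1, e2) and
   diagonalizing Rop on the complementary negative definite plane by a rotation
   of (e0, e1), all e_i ^ e_j become eigenbivectors, with eigenvalues l0, l1, l2.
   Then K is a bound below iff max(l1, l2) <= K <= l0, and the null curvature of
   x^perp, for x = a e0 + b e1 +- e2 with a^2 + b^2 = 1, is
   l0 - l1 b^2 - l2 a^2.  Bounds above reduce to bounds below for - R. *)
From HB Require Import structures.
Require Import Defs.
From mathcomp Require Import all_boot all_order all_algebra.
From mathcomp Require Import boolp classical_sets reals.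
From mathcomp Require Import ring lra.
From mathcomp Require polyrcf.

Set Implicit Arguments.
Unset Strict Implicit.
Unset Printing Implicit Defensive.

Import Order.TTheory GRing.Theory Num.Theory.
Local Open Scope ring_scope.

(** * Linear algebra in sizes two and three *)

Lemma det3 (R : comNzRingType) (a : nat -> nat -> R) :
  \det (\matrix_(i < 3, j < 3) a i j) =
  a 0 0 * (a 1 1 * a 2 2 - a 1 2 * a 2 1)
  - a 0 1 * (a 1 0 * a 2 2 - a 1 2 * a 2 0)
  + a 0 2 * (a 1 0 * a 2 1 - a 1 1 * a 2 0).
Proof.
rewrite (expand_det_row _ ord0) !big_ord_recl big_ord0 /cofactor.
rewrite !(expand_det_row _ ord0) !big_ord_recl !big_ord0 /cofactor !det_mx11.
rewrite !mxE /= /bump /=; ring.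
Qed.

(* Evaluating the form at the third column of the adjugate gives the
   determinant times the leading 2 x 2 minor. *)
Lemma posdef3_det_gt0 (R : realFieldType) (a b c d e f : R) :
  (forall x y z, (x != 0) || (y != 0) || (z != 0) ->
     0 < a * x ^+ 2 + d * y ^+ 2 + f * z ^+ 2
         + 2 * b * x * y + 2 * c * x * z + 2 * e * y * z) ->
  0 < a * (d * f - e ^+ 2) - b * (b * f - c * e) + c * (b * e - c * d).
Proof.
move=> pd.
have a0 : 0 < a by have := pd 1 0 0; rewrite oner_neq0 => /(_ isT); lra.
have m0 : 0 < a * d - b ^+ 2.
  (* The form takes the value [a * (a * d - b ^+ 2)] at this vector. *)
  have := pd (- b) a 0; rewrite (gt_eqF a0) /= orbT => /(_ isT) h.
  by rewrite -(pmulr_rgt0 _ a0); nra.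
have := pd (b * e - c * d) (b * c - a * e) (a * d - b ^+ 2).
rewrite (gt_eqF m0) orbT => /(_ isT) h.
rewrite -(pmulr_rgt0 _ m0); move: h; congr (0 < _); ring.
Qed.

(** The second equation says that the symmetric matrix with rows [(a, b)] and [(b, d)] has no
    off-diagonal entry in the rotated basis [(c, s)], [(- s, c)]. Any unit eigenvector serves as
    [(c, s)]. *)
Lemma diagonalizing_rotation (R : rcfType) (a b d : R) :
  exists c s, c ^+ 2 + s ^+ 2 = 1 /\ b * (c ^+ 2 - s ^+ 2) + c * s * (d - a) = 0.
Proof.
have [->|b0] := eqVneq b 0; first by exists 1, 0; split; ring.
pose D := Num.sqrt ((d - a) ^+ 2 + 4 * b ^+ 2).
have hD : D ^+ 2 = (d - a) ^+ 2 + 4 * b ^+ 2.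
  by rewrite sqr_sqrtr // addr_ge0 ?sqr_ge0 // mulr_ge0 ?sqr_ge0 ?ler0n.
(* [a + m] is the larger eigenvalue and [(b, m)] an eigenvector for it; [hm] is the characteristic
   equation written in [m]. *)
pose m := (d - a + D) / 2.
have hm : m ^+ 2 = (d - a) * m + b ^+ 2.
  suff -> : m ^+ 2 = (d - a) * m + (D ^+ 2 - (d - a) ^+ 2) / 4.
    by rewrite hD; field.
  by rewrite /m; field.
pose n := Num.sqrt (b ^+ 2 + m ^+ 2).
have n0 : n != 0.
  by rewrite gt_eqF // sqrtr_gt0 ltr_wpDr ?sqr_ge0 // exprn_even_gt0.
have hn : n ^+ 2 = b ^+ 2 + m ^+ 2 by rewrite sqr_sqrtr // addr_ge0 ?sqr_ge0.
exists (b / n), (m / n); split.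
  rewrite (_ : _ + _ = (b ^+ 2 + m ^+ 2) / n ^+ 2); last by field.
  by rewrite -hn divff // sqrf_eq0.
rewrite (_ : _ + _ = b * (b ^+ 2 - m ^+ 2 + (d - a) * m) / n ^+ 2); last by field.
by rewrite hm (_ : _ + _ = 0) ?mulr0 ?mul0r //; ring.
Qed.

(** * Vectors and bivectors in a Lorentz frame *)

Section LorentzFrames.
Context {R : realType} {V : vectType R}.
Variable g : {symmetric V}.
Implicit Types (v w : V) (K : R) (a b : bivector V).

Lemma symmetric_formC v w : g v w = g w v.
Proof. by rewrite hermC expr0 mul1r. Qed.

Lemma bivipC a b : bivip g a b = bivip g b a.
Proof.
have gT : (gram g)^T = gram g by apply/matrixP => i j; rewrite !mxE symmetric_formC.
rewrite /bivip -[in LHS]mxtrace_tr !trmx_mul trmxK gT; congr (_ * _).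
by rewrite mxtrace_mulC -!mulmxA.
Qed.

Lemma bivip_linr k a b b' :
  bivip g a (k *: b + b') = k * bivip g a b + bivip g a b'.
Proof.
rewrite /bivip [vsval (_ + _)]linearP /= mulmxDr mulmxDl -scalemxAr -scalemxAl.
by rewrite [\tr _]linearP /= mulrDr mulrCA.
Qed.

Lemma bivip_linl k a a' b :
  bivip g (k *: a + a') b = k * bivip g a b + bivip g a' b.
Proof. by rewrite bivipC bivip_linr !(bivipC b). Qed.

Lemma bivipDl a a' b : bivip g (a + a') b = bivip g a b + bivip g a' b.
Proof. by have := bivip_linl 1 a a' b; rewrite scale1r mul1r. Qed.

Lemma bivip0l b : bivip g 0 b = 0.
Proof. by have := bivip_linl (-1) 0 0 b; rewrite scaler0 addr0 mulN1r addNr. Qed.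

Lemma bivipZl k a b : bivip g (k *: a) b = k * bivip g a b.
Proof. by have := bivip_linl k a 0 b; rewrite addr0 bivip0l addr0. Qed.

Lemma bivipDr a b b' : bivip g a (b + b') = bivip g a b + bivip g a b'.
Proof. by rewrite !(bivipC a) bivipDl. Qed.

Lemma bivipZr k a b : bivip g a (k *: b) = k * bivip g a b.
Proof. by rewrite !(bivipC a) bivipZl. Qed.

Definition bivip_bilinear := (bivipDl, bivipDr, bivipZl, bivipZr).

Lemma wedge_lin3 (e0 e1 e2 : V) (v0 v1 v2 w0 w1 w2 : R) :
  wedge (v0 *: e0 + v1 *: e1 + v2 *: e2) (w0 *: e0 + w1 *: e1 + w2 *: e2) =
  (v0 * w1 - v1 * w0) *: wedge e0 e1 + (v0 * w2 - v2 * w0) *: wedge e0 e2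
  + (v1 * w2 - v2 * w1) *: wedge e1 e2.
Proof.
by apply: val_inj; rewrite /= /wedge_mx; apply/matrixP => i j;
  rewrite !mxE !(linearD, linearZ) /=; ring.
Qed.

Record lorentz_frame e0 e1 e2 : Prop := LorentzFrame {
  frame00 : g e0 e0 = 1;
  frame11 : g e1 e1 = 1;
  frame22 : g e2 e2 = -1;
  frame01 : g e0 e1 = 0;
  frame02 : g e0 e2 = 0;
  frame12 : g e1 e2 = 0;
  frame_span : forall v, exists x y z : R, v = x *: e0 + y *: e1 + z *: e2 }.

Lemma form_frame e0 e1 e2 x y z x' y' z' : lorentz_frame e0 e1 e2 ->
  g (x *: e0 + y *: e1 + z *: e2) (x' *: e0 + y' *: e1 + z' *: e2) =
  x * x' + y * y' - z * z'.
Proof.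
move=> E; rewrite !(linearDl, linearDr) !linearZl_LR !linearZr_LR /=.
rewrite (symmetric_formC e1 e0) (symmetric_formC e2 e0) (symmetric_formC e2 e1).
by rewrite !(frame00 E, frame11 E, frame22 E, frame01 E, frame02 E, frame12 E); ring.
Qed.

Lemma bivip_frame e0 e1 e2 p q r p' q' r' : lorentz_frame e0 e1 e2 ->
  bivip g (p *: wedge e0 e1 + q *: wedge e0 e2 + r *: wedge e1 e2)
    (p' *: wedge e0 e1 + q' *: wedge e0 e2 + r' *: wedge e1 e2) =
  p * p' - q * q' - r * r'.
Proof.
move=> E; rewrite !bivip_bilinear !bivipE.
rewrite (symmetric_formC e1 e0) (symmetric_formC e2 e0) (symmetric_formC e2 e1).
by rewrite !(frame00 E, frame11 E, frame22 E, frame01 E, frame02 E, frame12 E); ring.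
Qed.

Lemma bivector_wedge_sum b : exists c : 'I_(\dim {:V}) -> 'I_(\dim {:V}) -> R,
  b = \sum_i \sum_j c i j *: wedge (vbasis {:V})`_i (vbasis {:V})`_j.
Proof.
have bskew i j : vsval b j i = - vsval b i j.
  have := subvsP b; rewrite memv_ker.
  pose f (A : 'M[R]_(\dim {:V})) := A + A^T.
  have flin : linear f.
    by move=> k A B; rewrite /f linearP/= scalerDr addrACA.
  pose fL : {linear _ -> _} := HB.pack f (GRing.isLinear.Build _ _ _ _ f flin).
  rewrite -[linfun _]/(linfun fL) lfunE /= => /eqP/matrixP/(_ i j).
  by rewrite !mxE => /eqP; rewrite addrC addr_eq0 => /eqP.
(* The double sum meets each pair of indices in both orders, with equal contributions, hence the
   factor 1/2. *)
exists (fun i j => 2^-1 * vsval b i j); apply: val_inj => /=.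
rewrite linear_sum /=; apply/matrixP => k l; rewrite summxE.
have co (i j : 'I__) : coord (vbasis {:V}) i (vbasis {:V})`_j = (i == j)%:R.
  by rewrite coord_free ?(basis_free (vbasisP _)) // eq_sym.
under eq_bigr => i _.
  rewrite linear_sum /= summxE.
  under eq_bigr => j _.
    rewrite !mxE !co.
    over.
  over.
rewrite (_ : vsval b k l = 2^-1 * vsval b k l - 2^-1 * vsval b l k); last first.
  by rewrite (bskew k l); field.
have key (c : 'I_(\dim {:V}) -> 'I_(\dim {:V}) -> R) m n :
    \sum_i \sum_j c i j * ((m == i)%:R * (n == j)%:R) = c m n.
  rewrite (bigD1 m) //= [X in _ + X]big1 ?addr0.
    rewrite (bigD1 n) //= big1 ?addr0 ?eqxx ?mulr1 // => j /negPf.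
    by rewrite eq_sym => ->; rewrite !mulr0.
  move=> i /negPf; rewrite eq_sym => ->; apply: big1 => j _.
  by rewrite mul0r mulr0.
under eq_bigr => i _.
  under eq_bigr => j _ do rewrite mulrBr.
  rewrite big_split /=; over.
rewrite big_split /= key; congr (_ + _).
rewrite -[in LHS](key (fun i j => 2^-1 * vsval b i j) l k) -sumrN.
by apply: eq_bigr => i _; rewrite -sumrN; apply: eq_bigr.
Qed.

(** The combinations [S] are closed under sums and contain every multiple of a wedge, and a bivector
    is a sum of such multiples. *)
Lemma bivector_frame e0 e1 e2 b : lorentz_frame e0 e1 e2 ->
  exists p q r, b = p *: wedge e0 e1 + q *: wedge e0 e2 + r *: wedge e1 e2.
Proof.
move=> E; have [c ->] := bivector_wedge_sum b.
pose S b := exists p q r,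
  b = p *: wedge e0 e1 + q *: wedge e0 e2 + r *: wedge e1 e2.
have S0 : S 0 by exists 0, 0, 0; rewrite !scale0r !addr0.
have SD : forall a b, S a -> S b -> S (a + b).
  move=> _ _ [p [q [r ->]]] [p' [q' [r' ->]]].
  exists (p + p'), (q + q'), (r + r').
  by rewrite !scalerDl addrACA (addrACA (p *: _)).
apply: (big_ind S) => // i _; apply: (big_ind S) => // j _.
have [v0 [v1 [v2 ->]]] := frame_span E (vbasis {:V})`_i.
have [w0 [w1 [w2 ->]]] := frame_span E (vbasis {:V})`_j.
by rewrite wedge_lin3 !scalerDr !scalerA; do 3!eexists.
Qed.


(** Pairing a vanishing combination with each of the three vectors kills its coefficients, so the
    vectors are free, and by dimension they span. *)
Lemma orthonormal_frame e0 e1 e2 : \dim {:V} = 3%N ->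
  g e0 e0 = 1 -> g e1 e1 = 1 -> g e2 e2 = -1 ->
  g e0 e1 = 0 -> g e0 e2 = 0 -> g e1 e2 = 0 -> lorentz_frame e0 e1 e2.
Proof.
move=> dV h00 h11 h22 h01 h02 h12; split=> // v.
have Xb : basis_of {:V} [tuple e0; e1; e2].
  rewrite basisEfree subvf dV /= andbT; apply/freeP => k.
  rewrite !big_ord_recl big_ord0 /= addr0 => k0.
  have h w : k ord0 * g e0 w + (k (lift ord0 ord0) * g e1 w
      + k (lift ord0 (lift ord0 ord0)) * g e2 w) = 0.
    by rewrite -(linear0l g w) -k0 !linearDl !linearZl_LR.
  have := h e0; rewrite h00 symmetric_formC h01 symmetric_formC h02.
  rewrite !mulr0 !addr0 mulr1 => z0.
  have := h e1; rewrite h01 h11 (symmetric_formC e2) h12.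
  rewrite !mulr0 addr0 add0r mulr1 => z1.
  have := h e2; rewrite h02 h12 h22 !mulr0 !add0r mulrN1 => /eqP.
  rewrite oppr_eq0 => /eqP z2 i.
  case: (unliftP ord0 i) => [j ->|->] //.
  case: (unliftP ord0 j) => [l ->|->] //.
  by rewrite (ord1 l).
have := coord_basis Xb (memvf v).
rewrite !big_ord_recl big_ord0 addr0 addrA /= => hv.
by do 3!eexists; exact: hv.
Qed.

Lemma lorentz3_frame : lorentz3 g ->
  \dim {:V} = 3%N /\ exists e0 e1 e2, lorentz_frame e0 e1 e2.
Proof.
case=> e eb he; have dV : \dim {:V} = 3%N by rewrite -(size_basis eb).
split=> //; exists e`_0, e`_1, e`_2.
have o1 : (1 < 3)%N by [].
have o2 : (2 < 3)%N by [].
apply: orthonormal_frame => //.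
- exact: (he ord0 ord0).
- exact: (he (Ordinal o1) (Ordinal o1)).
- exact: (he (Ordinal o2) (Ordinal o2)).
- exact: (he ord0 (Ordinal o1)).
- exact: (he ord0 (Ordinal o2)).
- exact: (he (Ordinal o1) (Ordinal o2)).
Qed.

Lemma wedgeC v w : wedge v w = - wedge w v.
Proof.
by apply: val_inj; apply/matrixP => i j; rewrite !mxE opprB mulrC [X in _ - X]mulrC.
Qed.

Lemma comb3_eq (W : lmodType R) (u0 u1 u2 : W) (x y z x' y' z' : R) :
  x = x' -> y = y' -> z = z' ->
  x *: u0 + y *: u1 + z *: u2 = x' *: u0 + y' *: u1 + z' *: u2.
Proof. by move=> -> -> ->. Qed.

Lemma lorentz_frame_swap e0 e1 e2 :
  lorentz_frame e0 e1 e2 -> lorentz_frame e1 e0 e2.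
Proof.
case=> ? ? ? h01 ? ? sp; split=> //; first by rewrite symmetric_formC.
by move=> v; have [x [y [z ->]]] := sp v; exists y, x, z; rewrite [X in X + _]addrC.
Qed.

(** This turns a curvature bound, an inequality over pairs of vectors, into an inequality between
    quadratic forms on all bivectors. If [p = 0], then [e2] is a common factor; otherwise one can
    divide by [p]. *)
Lemma bivector_decomposable e0 e1 e2 b : lorentz_frame e0 e1 e2 ->
  exists v w, b = wedge v w.
Proof.
move=> E; have [p [q [r ->]]] := bivector_frame b E.
have [->|p0] := eqVneq p 0.
  exists (q *: e0 + r *: e1 + 0 *: e2), (0 *: e0 + 0 *: e1 + 1 *: e2).
  by rewrite wedge_lin3; apply: comb3_eq; ring.
exists (1 *: e0 + 0 *: e1 + (- (r / p)) *: e2), (0 *: e0 + p *: e1 + q *: e2).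
by rewrite wedge_lin3; apply: comb3_eq; field.
Qed.

(** The three wedges are orthogonal with square norms 1, -1, -1, whence the signs. *)
Lemma bivector_expand e0 e1 e2 b : lorentz_frame e0 e1 e2 ->
  b = bivip g b (wedge e0 e1) *: wedge e0 e1
    + (- bivip g b (wedge e0 e2)) *: wedge e0 e2
    + (- bivip g b (wedge e1 e2)) *: wedge e1 e2.
Proof.
move=> E; have [p [q [r ->]]] := bivector_frame b E; set c := (X in X = _).
have -> : bivip g c (wedge e0 e1) = p.
  have := bivip_frame p q r 1 0 0 E.
  by rewrite !scale0r scale1r !addr0 !mulr0 !subr0 mulr1.
have -> : bivip g c (wedge e0 e2) = - q.
  have := bivip_frame p q r 0 1 0 E.
  by rewrite !scale0r scale1r addr0 add0r !mulr0 subr0 mulr1 sub0r.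
have -> : bivip g c (wedge e1 e2) = - r.
  have := bivip_frame p q r 0 0 1 E.
  by rewrite !scale0r scale1r !add0r !mulr0 !sub0r oppr0 add0r mulr1.
by rewrite !opprK.
Qed.

Lemma bivip_nondegenerate e0 e1 e2 b : lorentz_frame e0 e1 e2 ->
  (forall a, bivip g b a = 0) -> b = 0.
Proof.
move=> E; have [p [q [r ->]]] := bivector_frame b E => h.
(* Flipping the two timelike components makes the product equal to [p ^+ 2 + q ^+ 2 + r ^+ 2]. *)
have := h (p *: wedge e0 e1 + (- q) *: wedge e0 e2 + (- r) *: wedge e1 e2).
rewrite bivip_frame // => s.
have -> : p = 0 by nra.
have -> : q = 0 by nra.
have -> : r = 0 by nra.
by rewrite !scale0r !addr0.
Qed.

(** * Semidefinite and definite forms of a self-adjoint operator *)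

Section Operator.
Variable f : 'End(bivector V).
Hypothesis f_adj : forall a b, bivip g (f a) b = bivip g a (f b).
Variables e0 e1 e2 : V.
Hypothesis E : lorentz_frame e0 e1 e2.

(** A zero of a semidefinite form lies in its radical: on the line [b + x *: c] the form equals
    [2 * x * S + x ^+ 2 * N], which is nonnegative for all [x] only if [S = 0]. *)
Lemma semidefinite_kernel K b :
  (forall c, K * bivip g c c <= bivip g (f c) c) ->
  bivip g (f b) b = K * bivip g b b ->
  forall c, bivip g (f b) c = K * bivip g b c.
Proof.
move=> psd hb c.
pose S := bivip g (f b) c - K * bivip g b c.
pose N := bivip g (f c) c - K * bivip g c c.
have N0 : 0 <= N by rewrite subr_ge0.
have h x : 0 <= 2 * x * S + x ^+ 2 * N.
  have := psd (b + x *: c); rewrite linearD linearZ /= !bivip_bilinear.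
  rewrite (bivipC (f c)) -f_adj (bivipC c) hb /S /N; lra.
suff : S = 0 by move/eqP; rewrite subr_eq0 => /eqP.
(* Dividing by [N + 1] instead of [N] covers the case [N = 0] as well. *)
have := h (- (S / (N + 1))).
have N1 : 0 < N + 1 by lra.
rewrite (_ : _ + _ = - (S ^+ 2 * (N + 2) / (N + 1) ^+ 2)); last first.
  by field; rewrite gt_eqF.
rewrite oppr_ge0 => h0; apply/eqP; rewrite -sqrf_eq0 eq_le sqr_ge0 andbT.
rewrite -(pmulr_lle0 _ (_ : 0 < (N + 2) / (N + 1) ^+ 2)) ?mulrA //.
by rewrite divr_gt0 ?exprn_gt0 //; lra.
Qed.

Lemma intermediate_posdef K1 K K2 b : K1 < K < K2 ->
  (forall c, K1 * bivip g c c <= bivip g (f c) c) ->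
  (forall c, K2 * bivip g c c <= bivip g (f c) c) ->
  b != 0 -> K * bivip g b b < bivip g (f b) b.
Proof.
move=> /andP[K1K KK2] p1 p2; rewrite ltNge; apply: contraNN => hb.
have := p1 b; have := p2 b => h2 h1.
(* With the assumed failure at [K], the bound [K1] forces the square norm to be nonnegative and [K2]
   forces it to be nonpositive. *)
have Q0 : bivip g b b = 0 by nra.
have A0 : bivip g (f b) b = 0 by move: hb h1; rewrite Q0 !mulr0 => ? ?; lra.
have k1 := semidefinite_kernel p1 (b := b).
have k2 := semidefinite_kernel p2 (b := b).
apply/eqP/(bivip_nondegenerate E) => c.
have := k1; rewrite Q0 A0 mulr0 => /(_ erefl c).
have := k2; rewrite Q0 A0 mulr0 => /(_ erefl c) -> /eqP.
rewrite -subr_eq0 -mulrBl mulf_eq0 subr_eq0 => /orP[/eqP|/eqP->//].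
by lra.
Qed.

End Operator.

End LorentzFrames.

(** * A spacelike eigenbivector from a root of the characteristic polynomial *)

Section SpacelikeEigenbivector.
Context {R : realType} {V : vectType R}.
Variable g : {symmetric V}.
Variable f : 'End(bivector V).
Hypothesis f_adj : forall a b, bivip g (f a) b = bivip g a (f b).
Variables e0 e1 e2 : V.
Hypothesis E : lorentz_frame g e0 e1 e2.

Lemma spacelike_eigenbivector_above K :
  (forall b, b != 0 -> K * bivip g b b < bivip g (f b) b) ->
  exists lam b, [/\ K < lam, bivip g b b = 1 & f b = lam *: b].
Proof.
move=> pd.
pose F := nth 0 [:: wedge e0 e1; wedge e0 e2; wedge e1 e2].
(* [q j] is the square norm of [F j], so row [i] of [M] lists the coordinates of [f (F i)]; matrices
   act on row vectors. *)
pose q (j : nat) : R := if j == 0%N then 1 else -1.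
pose M := \matrix_(i < 3, j < 3) (q j * bivip g (f (F i)) (F j)).
pose comb (u : 'rV[R]_3) := \sum_i u 0 i *: F i.
have combE u : comb u = u 0 ord0 *: wedge e0 e1
    + u 0 (lift ord0 ord0) *: wedge e0 e2
    + u 0 (lift ord0 (lift ord0 ord0)) *: wedge e1 e2.
  by rewrite /comb !big_ord_recl big_ord0 addr0 addrA.
have comb_neq0 u : u != 0 -> comb u != 0.
  apply: contraNneq => u0; apply/eqP/rowP => i; rewrite mxE.
  have h p' q' r' := bivip_frame (u 0 ord0) (u 0 (lift ord0 ord0))
    (u 0 (lift ord0 (lift ord0 ord0))) p' q' r' E.
  move: h; rewrite -combE u0 => h.
  have := h 1 0 0; have := h 0 1 0; have := h 0 0 1.
  rewrite !bivip0l => h2 h1 h0.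
  case: (unliftP ord0 i) => [j ->|->]; last by lra.
  case: (unliftP ord0 j) => [l ->|->]; last by lra.
  by rewrite (ord1 l); lra.
have fcomb u : f (comb u) = comb (u *m M).
  rewrite [LHS]linear_sum /= /comb; under eq_bigr => i _.
    rewrite linearZ /= [f (F i)](bivector_expand _ E); over.
  under [RHS]eq_bigr => j _ do rewrite mxE scaler_suml.
  rewrite exchange_big /=; apply: eq_bigr => i _.
  rewrite !big_ord_recl big_ord0 addr0 !mxE /q /= !mul1r !mulN1r.
  by rewrite -!scalerA -!scalerDr addrA.
have charE : (char_poly M).[K] =
    \det (\matrix_(i < 3, j < 3)
      (K *+ (i == j :> nat) - q j * bivip g (f (F i)) (F j))).
  rewrite -horner_evalE -det_map_mx; congr (\det _); apply/matrixP => i j.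
  by rewrite !mxE /= horner_evalE hornerD hornerN hornerC hornerMn hornerX.
have sym i j : bivip g (f (F i)) (F j) = bivip g (f (F j)) (F i).
  by rewrite f_adj bivipC.
have char_lt0 : (char_poly M).[K] < 0.
  rewrite charE (det3 (fun i j => K *+ (i == j) - q j * bivip g (f (F i)) (F j))).
  rewrite /q /= !mulr1n !mulr0n (sym 1 0) (sym 2 0) (sym 2 1).
  (* Negating the first row of the characteristic matrix at [K] gives the Gram matrix of the
     positive definite form, so the polynomial's value is minus a positive determinant. *)
  have := @posdef3_det_gt0 R (bivip g (f (F 0)) (F 0) - K)
    (bivip g (f (F 0)) (F 1)) (bivip g (f (F 0)) (F 2))
    (bivip g (f (F 1)) (F 1) + K) (bivip g (f (F 1)) (F 2))
    (bivip g (f (F 2)) (F 2) + K).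
  move=> posdet; rewrite -oppr_gt0.
  refine (eq_ind _ (fun d => 0 < d) (posdet _) _ _); last by ring.
  move=> x y z xyz; pose u := \row_(i < 3) nth 0 [:: x; y; z] i.
  have u0 : u != 0.
    apply: contraTneq xyz => /rowP u0; rewrite !negb_or !negbK.
    have := u0 ord0; have := u0 (lift ord0 ord0).
    have := u0 (lift ord0 (lift ord0 ord0)).
    by rewrite !mxE /= => -> -> ->; rewrite eqxx.
  have := pd _ (comb_neq0 _ u0); rewrite combE bivip_frame // !mxE /=.
  rewrite -[wedge e0 e1]/(F 0) -[wedge e0 e2]/(F 1) -[wedge e1 e2]/(F 2).
  rewrite !linearD !linearZ /= !bivip_bilinear (sym 1 0) (sym 2 0) (sym 2 1).
  by lra.
have lead1 : lead_coef (char_poly M) = 1.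
  by have /monicP := char_poly_monic M.
have lead_gt0 : 0 < lead_coef (char_poly M) by rewrite lead1 ltr01.
(* A monic polynomial is at least 1 far to the right, so the intermediate value theorem gives a root
   above [K]. *)
have [B hB] := polyrcf.poly_pinfty_gt_lc lead_gt0.
have [lam] : exists2 x, K <= x <= Num.max K B & root (char_poly M) x.
  apply: poly_ivt; first by rewrite le_max lexx.
  rewrite (ltW char_lt0) /= (le_trans ler01) // -lead1 hB //.
  by rewrite le_max lexx orbT.
case/andP => Klam _ rlam.
have Kl : K < lam.
  rewrite lt_neqAle Klam andbT; apply: contraTneq rlam => <-.
  by rewrite /root lt_eqF.
move: rlam; rewrite -eigenvalue_root_char => /eigenvalueP[u uM u0].
have fb : f (comb u) = lam *: comb u.
  rewrite fcomb uM /comb scaler_sumr; apply: eq_bigr => i _.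
  by rewrite mxE scalerA.
(* At an eigenbivector definiteness reads [K * Q < lam * Q] for its square norm [Q]; since
   [K < lam], it is spacelike and can be normalized. *)
have := pd _ (comb_neq0 _ u0); rewrite fb bivipZl => hQ.
have Q0 : 0 < bivip g (comb u) (comb u) by nra.
exists lam, ((Num.sqrt (bivip g (comb u) (comb u)))^-1 *: comb u); split=> //.
  rewrite bivipZl bivipZr mulrA -expr2 exprVn sqr_sqrtr ?ltW //.
  by rewrite mulVf // gt_eqF.
by rewrite linearZ /= fb !scalerA mulrC.
Qed.

End SpacelikeEigenbivector.

(** * Lorentz frames whose coordinate planes are eigenbivectors *)

Section EigenFrames.
Context {R : realType} {V : vectType R}.
Variable g : {symmetric V}.
Implicit Types (b : bivector V).

(* The reflection in the hyperplane orthogonal to [t + e2], with [t] the unit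
   timelike normal of the plane of [b], maps [e2] to [- t]; the images of [e0]
   and [e1] are an orthonormal basis of that plane. *)
Lemma spacelike_bivector_frame e0 e1 e2 b : \dim {:V} = 3%N ->
  lorentz_frame g e0 e1 e2 -> bivip g b b = 1 ->
  exists f0 f1 f2, lorentz_frame g f0 f1 f2 /\ b = wedge f0 f1.
Proof.
(* Exchanging [e0] and [e1] changes the sign of [p], and [p = 0] would make the square norm
   nonpositive. *)
move=> dV E b1; wlog [p [q [r [p0 bE]]]] : e0 e1 e2 E / exists p q r, 0 < p /\
    b = p *: wedge e0 e1 + q *: wedge e0 e2 + r *: wedge e1 e2.
  have [p [q [r bE]]] := bivector_frame b E => /[dup] h.
  have [p0 _|p0] := ltP 0 p; first by apply: (h e0 e1 e2) => //; exists p, q, r.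
  move=> _; apply: (h e1 e0 e2); first exact: lorentz_frame_swap.
  exists (- p), r, q; split.
    rewrite oppr_gt0 lt_neqAle p0 andbT; apply: contra_eq_neq b1 => pz.
    rewrite bE bivip_frame // pz lt_eqF //.
    by have := sqr_ge0 q; have := sqr_ge0 r; rewrite !expr2; lra.
  by rewrite bE (wedgeC e1 e0) scalerN scaleNr opprK -addrA [X in _ + X]addrC addrA.
have h : r ^+ 2 + q ^+ 2 - (p ^+ 2 - 1) = 0.
  by move: b1; rewrite bE bivip_frame // => b1; lra.
have p1 : 1 + p != 0 by rewrite gt_eqF // addr_gt0.
exists ((1 + r ^+ 2 / (1 + p)) *: e0 + (- (r * q / (1 + p))) *: e1 + (- r) *: e2).
exists ((- (r * q / (1 + p))) *: e0 + (1 + q ^+ 2 / (1 + p)) *: e1 + q *: e2).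
exists ((- r) *: e0 + q *: e1 + p *: e2).
(* Identities are checked modulo the norm relation [h]; [c] is the cofactor of that relation. *)
have modh (x y c : R) :
    x = y + c * (r ^+ 2 + q ^+ 2 - (p ^+ 2 - 1)) -> x = y.
  by rewrite h mulr0 addr0.
split; last first.
  rewrite wedge_lin3 bE; apply: comb3_eq.
  - by apply: (modh _ _ (- (1 + p)^-1)); field.
  - by field.
  - by field.
apply: orthonormal_frame; rewrite ?form_frame //.
- by apply: (modh _ _ (r ^+ 2 / (1 + p) ^+ 2)); field.
- by apply: (modh _ _ (q ^+ 2 / (1 + p) ^+ 2)); field.
- by apply: (modh _ _ 1); field.
- by apply: (modh _ _ (- (r * q / (1 + p) ^+ 2))); field.
- by apply: (modh _ _ (- (r / (1 + p)))); field.
- by apply: (modh _ _ (q / (1 + p))); field.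
Qed.

(** [l0] belongs to the spacelike coordinate plane, [l1] and [l2] to the two timelike ones. *)
Definition eigenframe (f : 'End(bivector V)) l0 l1 l2 e0 e1 e2 : Prop :=
  [/\ lorentz_frame g e0 e1 e2, f (wedge e0 e1) = l0 *: wedge e0 e1,
      f (wedge e0 e2) = l1 *: wedge e0 e2 &
      f (wedge e1 e2) = l2 *: wedge e1 e2].

Lemma eigenframe_exists (f : 'End(bivector V)) K1 K2 : lorentz3 g ->
  (forall a b, bivip g (f a) b = bivip g a (f b)) -> K1 < K2 ->
  (forall b, K1 * bivip g b b <= bivip g (f b) b) ->
  (forall b, K2 * bivip g b b <= bivip g (f b) b) ->
  exists l0 l1 l2 e0 e1 e2, eigenframe f l0 l1 l2 e0 e1 e2.
Proof.
move=> /lorentz3_frame[dV [d0 [d1 [d2 D]]]] f_adj K12 psd1 psd2.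
have Km : K1 < (K1 + K2) / 2 < K2 by apply/andP; split; lra.
have pd b := intermediate_posdef (b := b) f_adj D Km psd1 psd2.
have [l0 [b [_ b1 fb]]] := spacelike_eigenbivector_above f_adj D pd.
have [e0 [e1 [e2 [E bE]]]] := spacelike_bivector_frame dV D b1.
rewrite {}bE {b1} in fb.
(* The matrix diagonalized is that of the form [<f b, b>] on the span of [e0 ^ e2] and [e1 ^ e2].
   Rotating [e0, e1] fixes [e0 ^ e1] and rotates this span by the same angle. *)
have [c [s [cs1 cs0]]] := diagonalizing_rotation
  (bivip g (f (wedge e0 e2)) (wedge e0 e2))
  (bivip g (f (wedge e0 e2)) (wedge e1 e2))
  (bivip g (f (wedge e1 e2)) (wedge e1 e2)).
pose h0 := c *: e0 + s *: e1 + 0 *: e2.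
pose h1 := (- s) *: e0 + c *: e1 + 0 *: e2.
have e2E : e2 = 0 *: e0 + 0 *: e1 + 1 *: e2 by rewrite !scale0r !add0r scale1r.
have modcs (x y k : R) : x = y + k * (c ^+ 2 + s ^+ 2 - 1) -> x = y.
  by rewrite cs1 subrr mulr0 addr0.
have H : lorentz_frame g h0 h1 e2.
  apply: orthonormal_frame => //;
    rewrite ?(frame22 E) // ?[in g _ e2]e2E ?form_frame //.
  - by apply: (modcs _ _ 1); ring.
  - by apply: (modcs _ _ 1); ring.
  - by ring.
  - by ring.
  - by ring.
have H01 : wedge h0 h1 = wedge e0 e1.
  rewrite wedge_lin3 (_ : c * c - s * - s = 1); last first.
    by apply: (modcs _ _ 1); ring.
  by rewrite !(mul0r, mulr0) subrr !scale0r scale1r !addr0.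
have H02 : wedge h0 e2 = c *: wedge e0 e2 + s *: wedge e1 e2.
  rewrite [in LHS]e2E wedge_lin3 !(mul0r, mulr0, mulr1) !subr0.
  by rewrite scale0r add0r.
have H12 : wedge h1 e2 = (- s) *: wedge e0 e2 + c *: wedge e1 e2.
  rewrite [in LHS]e2E wedge_lin3 !(mul0r, mulr0, mulr1) !subr0.
  by rewrite scale0r add0r.
have fH01 : f (wedge h0 h1) = l0 *: wedge h0 h1 by rewrite H01.
(* By self-adjointness, [f] preserves the orthogonal complement of its eigenbivector. *)
have f01 b' : bivip g (f b') (wedge h0 h1) = l0 * bivip g b' (wedge h0 h1).
  by rewrite f_adj fH01 bivipZr.
have z02 : bivip g (f (wedge h0 e2)) (wedge h0 h1) = 0.
  rewrite f01 bivipE !(symmetric_formC g e2) (frame12 H) (frame02 H).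
  by rewrite !(mulr0, mul0r) subr0 mulr0.
have z12 : bivip g (f (wedge h1 e2)) (wedge h0 h1) = 0.
  rewrite f01 bivipE !(symmetric_formC g e2) (frame12 H) (frame02 H).
  by rewrite !(mulr0, mul0r) subr0 mulr0.
have z : bivip g (f (wedge h0 e2)) (wedge h1 e2) = 0.
  rewrite H02 H12 linearD !linearZ /= !bivip_bilinear.
  rewrite (f_adj (wedge e1 e2) (wedge e0 e2)) (bivipC _ (wedge e1 e2)).
  by rewrite -cs0; ring.
have z' : bivip g (f (wedge h1 e2)) (wedge h0 e2) = 0 by rewrite f_adj bivipC.
exists l0; do 2!eexists; exists h0, h1, e2; split; first exact: H.
- exact: fH01.
- by rewrite [LHS](bivector_expand _ H) z02 z oppr0 !scale0r addr0 add0r.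
- by rewrite [LHS](bivector_expand _ H) z12 z' oppr0 !scale0r !add0r.
Qed.

End EigenFrames.

(** * Curvature bounds, eigenbivectors and null curvature in an eigenframe *)

Section InEigenFrame.
Context {R : realType} {V : vectType R}.
Variable g : {symmetric V}.
Implicit Types (b : bivector V).
Variables (T : V -> V -> V -> V -> R) (f : 'End(bivector V)).
Hypothesis Tf : curvature_operator g T f.
Variables (l0 l1 l2 : R) (e0 e1 e2 : V).
Hypothesis E : eigenframe g f l0 l1 l2 e0 e1 e2.

Let frE : lorentz_frame g e0 e1 e2. Proof. by case: E. Qed.

Lemma eigenframe_apply p q r :
  f (p *: wedge e0 e1 + q *: wedge e0 e2 + r *: wedge e1 e2) =
  (l0 * p) *: wedge e0 e1 + (l1 * q) *: wedge e0 e2 + (l2 * r) *: wedge e1 e2.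
Proof.
have [_ f0 f1 f2] := E.
by rewrite !linearD !linearZ /= f0 f1 f2 !scalerA ![_ * l0]mulrC ![_ * l1]mulrC
           ![_ * l2]mulrC.
Qed.

Lemma eigenframe_bivip p q r :
  let b := p *: wedge e0 e1 + q *: wedge e0 e2 + r *: wedge e1 e2 in
  bivip g (f b) b = l0 * p ^+ 2 - l1 * q ^+ 2 - l2 * r ^+ 2.
Proof. by rewrite /= eigenframe_apply bivip_frame //; ring. Qed.

Lemma eigenframe_curv v0 v1 v2 w0 w1 w2 :
  let v := v0 *: e0 + v1 *: e1 + v2 *: e2 in
  let w := w0 *: e0 + w1 *: e1 + w2 *: e2 in
  T v w v w = l0 * (v0 * w1 - v1 * w0) ^+ 2 - l1 * (v0 * w2 - v2 * w0) ^+ 2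
              - l2 * (v1 * w2 - v2 * w1) ^+ 2.
Proof. by move=> v w; rewrite -Tf.2 wedge_lin3 eigenframe_bivip. Qed.

Lemma frame_coord0 : e0 = 1 *: e0 + 0 *: e1 + 0 *: e2.
Proof. by rewrite !scale0r scale1r !addr0. Qed.

Lemma frame_coord1 : e1 = 0 *: e0 + 1 *: e1 + 0 *: e2.
Proof. by rewrite !scale0r scale1r addr0 add0r. Qed.

Lemma frame_coord2 : e2 = 0 *: e0 + 0 *: e1 + 1 *: e2.
Proof. by rewrite !scale0r scale1r !add0r. Qed.

(** Necessity is seen on the three coordinate planes. For sufficiency, the defect of the inequality
    is a sum of squares of the components of [v ^ w], weighted by [l0 - K], [K - l1], [K - l2]. *)
Lemma eigenframe_bound_below K :
  curv_bound_below g T K <-> [/\ l1 <= K, l2 <= K & K <= l0].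
Proof.
split=> [h|[h1 h2 h0] v w].
  have H v0 v1 v2 w0 w1 w2 := h (v0 *: e0 + v1 *: e1 + v2 *: e2)
    (w0 *: e0 + w1 *: e1 + w2 *: e2).
  have := H 1 0 0 0 1 0; have := H 1 0 0 0 0 1; have := H 0 1 0 0 0 1.
  by rewrite !eigenframe_curv !form_frame //; split; lra.
have [v0 [v1 [v2 ->]]] := frame_span frE v.
have [w0 [w1 [w2 ->]]] := frame_span frE w.
rewrite eigenframe_curv !form_frame // -subr_ge0.
rewrite (_ : _ - _ = (l0 - K) * (v0 * w1 - v1 * w0) ^+ 2
  + (K - l1) * (v0 * w2 - v2 * w0) ^+ 2
  + (K - l2) * (v1 * w2 - v2 * w1) ^+ 2); last by ring.
by rewrite !addr_ge0 // mulr_ge0 ?sqr_ge0 // subr_ge0.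
Qed.

(** Both [[K1, K2]] and the interval from [max(l1, l2)] to [l0] are the full set of bounds below, so
    their endpoints agree. *)
Lemma eigenframe_bounds K1 K2 : K1 <= K2 ->
  (forall K, curv_bound_below g T K <-> K1 <= K <= K2) ->
  [/\ K2 = l0, l1 <= K1, l2 <= K1 & l1 = K1 \/ l2 = K1].
Proof.
move=> K12 hK.
have [a1 a2 a0] : [/\ l1 <= K1, l2 <= K1 & K1 <= l0].
  by apply/eigenframe_bound_below/hK; rewrite lexx.
have [_ _ c0] : [/\ l1 <= K2, l2 <= K2 & K2 <= l0].
  by apply/eigenframe_bound_below/hK; rewrite lexx andbT.
have /hK/andP[_ h0] : curv_bound_below g T l0.
  by apply/eigenframe_bound_below; split; lra.
have /hK/andP[h1 _] : curv_bound_below g T (Num.max l1 l2).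
  apply/eigenframe_bound_below; rewrite ge_max !le_max !lexx orbT; split=> //.
  by apply/andP; split; lra.
split=> //; first by lra.
by move: h1; rewrite le_max => /orP[] ?; [left|right]; lra.
Qed.

Lemma eigenframe_diagonalizable : diagonalizable_lfun f.
Proof.
have [_ f0 f1 f2] := E.
exists [:: wedge e0 e1; wedge e0 e2; wedge e1 e2]; last first.
  by move=> u; rewrite !inE => /or3P[]/eqP->; [exists l0|exists l1|exists l2].
rewrite -[X in basis_of _ X]/(tval [tuple wedge e0 e1; wedge e0 e2; wedge e1 e2]).
set X := [tuple _; _; _]; have dW : (\dim {:bivector V} <= 3)%N.
  suff <- : <<X>>%VS = fullv by apply: leq_trans (dim_span _) _.
  apply/eqP; rewrite eqEsubv subvf; apply/subvP => b _.
  have [p [q [r ->]]] := bivector_frame b frE.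
  by rewrite !memvD // memvZ // memv_span // !inE eqxx ?orbT.
rewrite basisEfree subvf size_tuple dW !andbT.
apply/freeP => k; rewrite !big_ord_recl big_ord0 /= addr0 addrA => k0.
have h p q r := bivip_frame (k ord0) (k (lift ord0 ord0))
  (k (lift ord0 (lift ord0 ord0))) p q r frE.
move: h; rewrite k0 => h.
have := h 1 0 0; have := h 0 1 0; have := h 0 0 1.
rewrite !bivip0l => z2 z1 z0 i.
case: (unliftP ord0 i) => [j ->|->]; last by lra.
case: (unliftP ord0 j) => [l ->|->]; last by lra.
by rewrite (ord1 l); lra.
Qed.

(** A spacelike [b] has a nonzero [e0 ^ e1] component, so its eigenvalue is [l0]; the strict gaps
    then annihilate the other two components. *)
Lemma eigenframe_spacelike b : l1 < l0 -> l2 < l0 ->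
  eigenbivector f b -> spacelike_bivector g b ->
  exists2 k, k != 0 & b = k *: wedge e0 e1.
Proof.
move=> l10 l20 [b0 [k fb]]; rewrite /spacelike_bivector => bs.
have [p [q [r bE]]] := bivector_frame b frE.
have hf x y z : x * (l0 * p) - y * (l1 * q) - z * (l2 * r) =
                k * (x * p - y * q - z * r).
  rewrite -!(bivip_frame _ _ _ _ _ _ frE) -eigenframe_apply -bE fb.
  by rewrite bivipZr.
move: bs; rewrite bE bivip_frame // => bs.
have p0 : p != 0.
  by apply: contraTneq bs => ->; rewrite -leNgt; nra.
have kl0 : k = l0.
  have /eqP := hf 1 0 0; rewrite !mul0r !mul1r !subr0 => /eqP h.
  by apply: (mulIf p0); rewrite -h.
have q0 : q = 0.
  have := hf 0 1 0; rewrite kl0 => /eqP; rewrite -subr_eq0.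
  rewrite (_ : _ - _ = (l0 - l1) * q); last by ring.
  by rewrite mulf_eq0 subr_eq0 gt_eqF //= => /eqP.
have r0 : r = 0.
  have := hf 0 0 1; rewrite kl0 => /eqP; rewrite -subr_eq0.
  rewrite (_ : _ - _ = (l0 - l2) * r); last by ring.
  by rewrite mulf_eq0 subr_eq0 gt_eqF //= => /eqP.
by exists p => //; rewrite q0 r0 !scale0r !addr0.
Qed.

Lemma eigenframe_spacelike01 :
  eigenbivector f (wedge e0 e1) /\ spacelike_bivector g (wedge e0 e1).
Proof.
have [_ f0 _ _] := E.
have Q1 : bivip g (wedge e0 e1) (wedge e0 e1) = 1.
  by rewrite bivipE (frame00 frE) (frame11 frE) (frame01 frE) mul0r mulr1 subr0.
split; last by rewrite /spacelike_bivector Q1.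
split; last by exists l0.
by apply: contra_eq_neq Q1 => ->; rewrite bivip0l eq_sym oner_neq0.
Qed.

Lemma perp_wedge01 k t : k != 0 -> unit_vector g t -> timelike g t ->
  perp_bivector g t (k *: wedge e0 e1) -> exists2 s, s ^+ 2 = 1 & t = s *: e2.
Proof.
rewrite /unit_vector /timelike => k0 ut tt [P [_ [v [w [bE PE]]]] tP].
have [t0 [t1 [t2 tE]]] := frame_span frE t.
have tv : g v t = 0.
  rewrite symmetric_formC; apply: (mem_orthovP tP).
  by rewrite PE (subvP (addvSl _ _)) ?memv_line.
have tw : g w t = 0.
  rewrite symmetric_formC; apply: (mem_orthovP tP).
  by rewrite PE (subvP (addvSr _ _)) ?memv_line.
(* The left side is the product of [e0 ^ e1] with [t ^ y]. It can be computed from [v ^ w] instead,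
   without comparing the two pairs of vectors. *)
have hy y : g e0 t * g e1 y - g e0 y * g e1 t = 0.
  apply: (mulfI k0); rewrite mulr0 -bivipE -bivipZl bE bivipE tv tw.
  by rewrite mul0r mulr0 subr0.
have c0 : g e0 t = t0 by rewrite tE [in X in g X _]frame_coord0 form_frame //; ring.
have c1 : g e1 t = t1 by rewrite tE [in X in g X _]frame_coord1 form_frame //; ring.
have := hy e0; have := hy e1; rewrite c0 c1 (frame00 frE) (frame11 frE).
rewrite (frame01 frE) (symmetric_formC g e1) (frame01 frE).
rewrite !(mul0r, mulr0, mulr1, mul1r, subr0, sub0r) => z0 /eqP.
rewrite oppr_eq0 => /eqP z1.
exists t2; last by rewrite tE z0 z1 !scale0r !add0r.
by move: ut; rewrite ltr0_norm // tE z0 z1 form_frame // => <-; ring.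
Qed.

(* A vector [u] of [x^perp] has [g u u = D ^+ 2], and [u ^ x] is [D] times the
   bivector [e0 ^ e1 + s b e0 ^ e2 - s a e1 ^ e2]. *)
Lemma eigenframe_null_curvature (a b s : R) : a ^+ 2 + b ^+ 2 = 1 -> s ^+ 2 = 1 ->
  let x := a *: e0 + b *: e1 + s *: e2 in
  null_curvature g T x (orthov g <[x]>%VS) = l0 - l1 * b ^+ 2 - l2 * a ^+ 2.
Proof.
move=> ab s1 x; rewrite /null_curvature.
(* The default value of [xget] is excluded by a unit spacelike vector perpendicular to [x];
   otherwise [u] is an arbitrary nonnull vector of the section. *)
case: xgetP => [u _ /= []|/(_ ((- b) *: e0 + a *: e1 + 0 *: e2)) []]; last first.
  rewrite /= mem_orthov1 !form_frame // (_ : _ - _ = 0) ?eqxx; last by ring.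
  split=> //; rewrite (_ : _ - _ = a ^+ 2 + b ^+ 2); last by ring.
  by rewrite ab oner_neq0.
have [u0 [u1 [u2 ->]]] := frame_span frE u.
rewrite mem_orthov1 !form_frame // => /eqP ux.
have u2E : u2 = s * (u0 * a + u1 * b).
  rewrite [LHS](_ : _ = s * (u0 * a + u1 * b) + (1 - s ^+ 2) * u2
    - s * (u0 * a + u1 * b - u2 * s)); last by ring.
  by rewrite s1 ux subrr mul0r mulr0 subr0 addr0.
pose D := u0 * b - u1 * a.
have uuE : u0 * u0 + u1 * u1 - u2 * u2 = D ^+ 2.
  rewrite u2E (_ : _ - _ = D ^+ 2 + (u0 ^+ 2 + u1 ^+ 2) * (1 - (a ^+ 2 + b ^+ 2))
    + (1 - s ^+ 2) * (u0 * a + u1 * b) ^+ 2); last by rewrite /D; ring.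
  by rewrite ab s1 subrr mulr0 mul0r !addr0.
have h02 : u0 * s - u2 * a = s * b * D.
  rewrite u2E (_ : _ - _ = s * b * D + s * u0 * (1 - (a ^+ 2 + b ^+ 2))).
    by rewrite ab subrr mulr0 addr0.
  by rewrite /D; ring.
have h12 : u1 * s - u2 * b = - (s * a * D).
  rewrite u2E (_ : _ - _ = - (s * a * D) + s * u1 * (1 - (a ^+ 2 + b ^+ 2))).
    by rewrite ab subrr mulr0 addr0.
  by rewrite /D; ring.
rewrite uuE => D0; rewrite eigenframe_curv h02 h12 sqrrN !exprMn s1 !mul1r -/D.
have d0 : D != 0 by rewrite -sqrf_eq0.
by field.
Qed.

End InEigenFrame.

(** * Extremal null curvature for bounds below, then for bounds above *)

Definition diagonalizable_with_min_null_curvature (R : realType) (V : vectType R)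
    (g : {symmetric V}) (T : V -> V -> V -> V -> R) (f : 'End(bivector V)) m :=
  [/\ diagonalizable_lfun f,
      exists b : bivector V,
        [/\ eigenbivector f b, spacelike_bivector g b &
            forall b' : bivector V,
              eigenbivector f b' -> spacelike_bivector g b' ->
              exists k : R, b' = k *: b] &
      forall (b : bivector V) (t : V),
        eigenbivector f b -> spacelike_bivector g b ->
        unit_vector g t -> timelike g t -> perp_bivector g t b ->
        is_min
          [set null_curvature g T (t + v) (orthov g <[t + v]>%VS)
            | v in [set v : V | unit_vector g v /\ g v t = 0]]%classic
          m].

Lemma bounded_below_min_null_curvature (R : realType) (V : vectType R)
    (g : {symmetric V}) (T : V -> V -> V -> V -> R) (f : 'End(bivector V))
    (K1 K2 : R) :
  lorentz3 g -> curvature_operator g T f -> K1 < K2 ->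
  (forall K : R, curv_bound_below g T K <-> K1 <= K <= K2) ->
  diagonalizable_with_min_null_curvature g T f (K2 - K1).
Proof.
move=> L Tf K12 hK.
have [_ [d0 [d1 [d2 D]]]] := lorentz3_frame L.
have psd K : curv_bound_below g T K ->
    forall b, K * bivip g b b <= bivip g (f b) b.
  move=> h b; have [v [w ->]] := bivector_decomposable b D.
  by rewrite Tf.2 bivipE (symmetric_formC g w v) -expr2; apply: h.
have [l0 [l1 [l2 [e0 [e1 [e2 E]]]]]] : exists l0 l1 l2 e0 e1 e2,
    eigenframe g f l0 l1 l2 e0 e1 e2.
  by apply: (eigenframe_exists L Tf.1 K12); apply/psd/hK; rewrite lexx ltW.
have [K2E l1K l2K lK] := eigenframe_bounds Tf E (ltW K12) hK.
have l10 : l1 < l0 by rewrite -K2E; lra.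
have l20 : l2 < l0 by rewrite -K2E; lra.
have [F _ _ _] := E.
split; first exact: eigenframe_diagonalizable E.
  exists (wedge e0 e1); have [eb sb] := eigenframe_spacelike01 E; split=> // b'.
  move=> eb' sb'; have [k _ ->] := eigenframe_spacelike E l10 l20 eb' sb'.
  by exists k.
move=> b t eb sb ut tt pt.
have [k k0 bE] := eigenframe_spacelike E l10 l20 eb sb.
rewrite {}bE {b eb sb} in pt.
have [s s1 ->] := perp_wedge01 E k0 ut tt pt.
have gv x y z : g (x *: e0 + y *: e1 + z *: e2) (s *: e2) = - (z * s).
  rewrite linearZr_LR /= [in X in g _ X](frame_coord2 e0 e1 e2).
  by rewrite form_frame //; ring.
have nc x y : x ^+ 2 + y ^+ 2 = 1 ->
    null_curvature g T (s *: e2 + (x *: e0 + y *: e1))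
      (orthov g <[s *: e2 + (x *: e0 + y *: e1)]>%VS) =
    l0 - l1 * y ^+ 2 - l2 * x ^+ 2.
  by move=> xy; rewrite addrC (eigenframe_null_curvature Tf E).
have key x y : x ^+ 2 + y ^+ 2 = 1 ->
    unit_vector g (x *: e0 + y *: e1) /\ g (x *: e0 + y *: e1) (s *: e2) = 0.
  move=> xy; have := gv x y 0; have := form_frame x y 0 x y 0 F.
  rewrite !scale0r !addr0 !mul0r subr0 oppr0 -!expr2 xy => g1 ->.
  by rewrite /unit_vector g1 normr1.
split.
  (* The minimum is attained at [v = e1] if [l1 = K1], and at [v = e0] if [l2 = K1]. *)
  case: lK => lK.
    have xy : (0 : R) ^+ 2 + 1 ^+ 2 = 1 by ring.
    by exists (0 *: e0 + 1 *: e1); [exact: key|rewrite nc // K2E -lK; ring].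
  have xy : (1 : R) ^+ 2 + 0 ^+ 2 = 1 by ring.
  by exists (1 *: e0 + 0 *: e1); [exact: key|rewrite nc // K2E -lK; ring].
move=> _ [v [uv vt] <-].
have [x [y [z vE]]] := frame_span F v; rewrite {}vE in uv vt *.
have z0 : z = 0.
  have s0 : s != 0 by rewrite -sqrf_eq0 s1 oner_neq0.
  by move/eqP: vt; rewrite gv oppr_eq0 mulf_eq0 (negPf s0) orbF => /eqP.
rewrite {}z0 {vt} in uv *; rewrite scale0r addr0.
have xy : x ^+ 2 + y ^+ 2 = 1.
  move: uv; rewrite /unit_vector form_frame // mul0r subr0 -!expr2.
  by rewrite ger0_norm // addr_ge0 ?sqr_ge0.
rewrite nc // K2E.
(* Since [v] is a unit vector, this shows the null curvature as [K2 - K1] plus nonnegative terms. *)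
have -> : l0 - l1 * y ^+ 2 - l2 * x ^+ 2 =
    l0 - K1 * (x ^+ 2 + y ^+ 2) + (K1 - l1) * y ^+ 2 + (K1 - l2) * x ^+ 2 by ring.
by rewrite xy mulr1 -addrA lerDl addr_ge0 // mulr_ge0 ?sqr_ge0 // subr_ge0.
Qed.

Theorem proposition6p3 (R : realType) (V : vectType R) (g : {symmetric V})
    (T : V -> V -> V -> V -> R) (Rop : 'End(bivector V)) (K1 K2 : R) :
  lorentz3 g -> algebraic_curvature_tensor T -> curvature_operator g T Rop ->
  K1 < K2 ->
  ((forall K : R, curv_bound_below g T K <-> K1 <= K <= K2) ->
    [/\ diagonalizable_lfun Rop,
        exists b : bivector V,
          [/\ eigenbivector Rop b, spacelike_bivector g b &
              forall b' : bivector V,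
                eigenbivector Rop b' -> spacelike_bivector g b' ->
                exists k : R, b' = k *: b] &
        forall (b : bivector V) (t : V),
          eigenbivector Rop b -> spacelike_bivector g b ->
          unit_vector g t -> timelike g t -> perp_bivector g t b ->
          is_min
            [set null_curvature g T (t + v) (orthov g <[t + v]>%VS)
              | v in [set v : V | unit_vector g v /\ g v t = 0]]%classic
            (K2 - K1)])
  /\
  ((forall K : R, curv_bound_above g T K <-> K1 <= K <= K2) ->
    [/\ diagonalizable_lfun Rop,
        exists b : bivector V,
          [/\ eigenbivector Rop b, spacelike_bivector g b &
              forall b' : bivector V,
                eigenbivector Rop b' -> spacelike_bivector g b' ->
                exists k : R, b' = k *: b] &
        forall (b : bivector V) (t : V),
          eigenbivector Rop b -> spacelike_bivector g b ->
          unit_vector g t -> timelike g t -> perp_bivector g t b ->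
          is_max
            [set null_curvature g T (t + v) (orthov g <[t + v]>%VS)
              | v in [set v : V | unit_vector g v /\ g v t = 0]]%classic
            (K1 - K2)]).
Proof.
move=> L _ Tf K12; split; first exact: bounded_below_min_null_curvature.
(* For [- T] and [- Rop] the bounds below fill [[- K2, - K1]], while the eigenbivectors are
   unchanged. *)
move=> hK; pose T' v w x y := - T v w x y.
have Tf' : curvature_operator g T' (- Rop).
  split=> [a b|v w]; rewrite !opp_lfunE -!scaleN1r.
    by rewrite bivipZl bivipZr Tf.1.
  by rewrite bivipZl Tf.2 mulN1r.
have hK' K : curv_bound_below g T' K <-> - K2 <= K <= - K1.
  have -> : (- K2 <= K <= - K1) = (K1 <= - K <= K2).
    by rewrite lerNl lerNr andbC.
  rewrite -hK; split=> h v w; have := h v w; rewrite /T' mulNr.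
    by rewrite lerNr.
  by rewrite lerNr.
have K12' : - K2 < - K1 by rewrite ltrN2.
have eigN b : eigenbivector Rop b -> eigenbivector (- Rop) b.
  move=> [b0 [k fb]]; split=> //; exists (- k).
  by rewrite opp_lfunE fb scaleNr.
have eigN' b : eigenbivector (- Rop) b -> eigenbivector Rop b.
  move=> [b0 [k]]; rewrite opp_lfunE => fb; split=> //; exists (- k).
  by rewrite scaleNr -fb opprK.
have [[e eb he] [b [hb sb ub]] hmin] :=
  bounded_below_min_null_curvature L Tf' K12' hK'.
(* The vector picked by [xget] depends only on [g] and [P], so it is the same for both tensors. *)
have ncN x P : null_curvature g T' x P = - null_curvature g T x P.
  by rewrite /null_curvature /= mulNr.
split.
- exists e => // u /he[k]; rewrite opp_lfunE => fu; exists (- k).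
  by rewrite scaleNr -fu opprK.
- exists b; split=> // [|b' /eigN hb' sb']; [exact: eigN'|exact: ub].
- move=> {hb sb ub}b t /eigN hb sb ut tt pt.
  (* The minimum [- K1 - (- K2)] of the negated null curvatures is the negative of the required
     maximum. *)
  have [[v vt vE] lb] := hmin b t hb sb ut tt pt.
  split.
    by exists v => //; rewrite -[LHS]opprK -ncN vE; ring.
  move=> _ [w wt <-].
  by have := lb _ (ex_intro2 _ _ w wt erefl); rewrite ncN; lra.
Qed.
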